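(* Let $\phi\colon R\to S$ be a morphism of restriction quantal frames. Then $B\mapsto\phi^{-1}(B)$ is a well-defined continuous covering functor $\phi^{-1}\colon\mathsf{C}(S)\to\mathsf{C}(R)$; in particular $\mathbf{d}(\phi^{-1}(B))=\phi^{-1}(\mathbf{d}(B))$ and $\mathbf{r}(\phi^{-1}(B))=\phi^{-1}(\mathbf{r}(B))$ for every completely prime filter $B$ of $S$.
   Context: A restriction quantal frame is a frame $(Q,\le)$ with associative multiplication distributing over arbitrary joins on both sides, which is a monoid with identity $e$ and carries join-preserving unary operations $a\mapsto a^{\ast}$, $a\mapsto a^{+}$ with values in the set $e^{\downarrow}=\{x:x\le e\}$ of projections (a commutative subsemigroup of idempotents), fixing projections, with $aa^{\ast}=a$, $a^{+}a=a$, $(ab)^{\ast}=(a^{\ast}b)^{\ast}$, $(ab)^{+}=(ab^{+})^{+}$; the top element is a join of partial isometries ($a$ with $b\le a\Rightarrow b=b^{+}a=ab^{\ast}$) and partial isometries are closed under product. A morphism of restriction quantal frames is a semigroup homomorphism preserving all joins, finite meets, $\ast$ and $+$, the top element and the monoid identity, and mapping partial isometries to partial isometries. A completely prime filter is a nonempty upward closed subset closed under binary meets, not containing $0$, such that whenever $\bigvee_i a_i$ lies in it some $a_i$ does. $\mathsf{C}(Q)$ is the category of completely prime filters with $\mathbf{d}(A)=\{x:\exists a\in A,\ a^{\ast}\le x\}$, $\mathbf{r}(A)=\{x:\exists a\in A,\ a^{+}\le x\}$, $A\cdot B=\{x:\exists a\in A,b\in B,\ ab\le x\}$ defined iff $\mathbf{d}(A)=\mathbf{r}(B)$,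 topologized by the base $\mathscr{X}_a=\{A:a\in A\}$, $a$ a partial isometry. A functor $F$ is a covering functor if it is $\mathbf{d}$-injective ($F(x)=F(y)$, $\mathbf{d}(x)=\mathbf{d}(y)\Rightarrow x=y$), $\mathbf{d}$-surjective (if $F(e)=\mathbf{d}(y)$ for an identity $e$, there is $x$ with $\mathbf{d}(x)=e$, $F(x)=y$), and likewise $\mathbf{r}$-injective and $\mathbf{r}$-surjective. *)

(* Defs.v *)
Set Implicit Arguments.

Definition img (A B : Type) (f : A -> B) (X : A -> Prop) : B -> Prop :=
  fun y => exists x, X x /\ y = f x.

Record RQF := {
  car :> Type;
  le : car -> car -> Prop;
  sup : (car -> Prop) -> car;
  meet : car -> car -> car;
  mul : car -> car -> car;
  one : car;
  star : car -> car;
  plus : car -> car;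
  le_refl : forall a, le a a;
  le_trans : forall a b c, le a b -> le b c -> le a c;
  le_antisym : forall a b, le a b -> le b a -> a = b;
  sup_ub : forall X a, X a -> le a (sup X);
  sup_lub : forall X b, (forall a, X a -> le a b) -> le (sup X) b;
  meet_lbl : forall a b, le (meet a b) a;
  meet_lbr : forall a b, le (meet a b) b;
  meet_glb : forall a b c, le c a -> le c b -> le c (meet a b);
  meet_sup : forall a X, meet a (sup X) = sup (img (meet a) X);
  mulA : forall a b c, mul a (mul b c) = mul (mul a b) c;
  mul1l : forall a, mul one a = a;
  mul1r : forall a, mul a one = a;
  mul_supr : forall a X, mul a (sup X) = sup (img (mul a) X);
  mul_supl : forall a X, mul (sup X) a = sup (img (fun x => mul x a) X);
  (* the projections e^down form a commutative subsemigroup of idempotents *)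
  proj_mul : forall p q, le p one -> le q one -> le (mul p q) one;
  proj_comm : forall p q, le p one -> le q one -> mul p q = mul q p;
  proj_idem : forall p, le p one -> mul p p = p;
  star_sup : forall X, star (sup X) = sup (img star X);
  plus_sup : forall X, plus (sup X) = sup (img plus X);
  star_proj : forall a, le (star a) one;
  plus_proj : forall a, le (plus a) one;
  star_fix : forall p, le p one -> star p = p;
  plus_fix : forall p, le p one -> plus p = p;
  mul_star : forall a, mul a (star a) = a;
  plus_mul : forall a, mul (plus a) a = a;
  star_mulE : forall a b, star (mul a b) = star (mul (star a) b);
  plus_mulE : forall a b, plus (mul a b) = plus (mul a (plus b));
  top_pisom : exists X : car -> Prop,
      (forall a, X a -> forall b, le b a -> b = mul (plus b) a /\ b = mul a (star b))
      /\ sup X = sup (fun _ => True);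
  pisom_mul : forall a b,
      (forall c, le c a -> c = mul (plus c) a /\ c = mul a (star c)) ->
      (forall c, le c b -> c = mul (plus c) b /\ c = mul b (star c)) ->
      (forall c, le c (mul a b) -> c = mul (plus c) (mul a b) /\ c = mul (mul a b) (star c))
}.

Arguments le {r}.
Arguments sup {r}.
Arguments meet {r}.
Arguments mul {r}.
Arguments one {r}.
Arguments star {r}.
Arguments plus {r}.

Section Q.
Context {Q : RQF}.

Definition top : Q := sup (fun _ => True).
Definition bot : Q := sup (fun _ => False).

Definition pisom (a : Q) : Prop :=
  forall b, le b a -> b = mul (plus b) a /\ b = mul a (star b).

Definition cpf (A : Q -> Prop) : Prop :=
  (exists a, A a) /\
  (forall a b, A a -> le a b -> A b) /\
  (forall a b, A a -> A b -> A (meet a b)) /\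
  ~ A bot /\
  (forall X, A (sup X) -> exists a, X a /\ A a).

Definition dom (A : Q -> Prop) : Q -> Prop := fun x => exists a, A a /\ le (star a) x.
Definition rng (A : Q -> Prop) : Q -> Prop := fun x => exists a, A a /\ le (plus a) x.
(* the product A . B (only meaningful when dom A = rng B) *)
Definition cprod (A B : Q -> Prop) : Q -> Prop :=
  fun x => exists a b, A a /\ B b /\ le (mul a b) x.
Definition is_ident (A : Q -> Prop) : Prop := cpf A /\ dom A = A.

(** topology on C(Q) with base X_a = {A | a in A}, a a partial isometry:
    U is open iff it is a union of basic opens *)
Definition isOpen (U : (Q -> Prop) -> Prop) : Prop :=
  forall A, cpf A -> U A ->
    exists a, pisom a /\ A a /\ (forall A', cpf A' -> A' a -> U A').
End Q.

Definition rqf_morph (R S : RQF) (f : R -> S) : Prop :=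
  (forall a b, f (mul a b) = mul (f a) (f b)) /\
  (forall X, f (sup X) = sup (img f X)) /\
  (forall a b, f (meet a b) = meet (f a) (f b)) /\
  (forall a, f (star a) = star (f a)) /\
  (forall a, f (plus a) = plus (f a)) /\
  f (@top R) = @top S /\
  f one = one /\
  (forall a : R, pisom a -> pisom (f a)).

Definition preim (R S : RQF) (f : R -> S) (B : S -> Prop) : R -> Prop :=
  fun x => B (f x).

(** F : C(S) -> C(R) (given as a function on sets, considered on cpfs) is a
    continuous covering functor *)
Definition is_functor (R S : RQF) (F : (S -> Prop) -> (R -> Prop)) : Prop :=
  (forall B, cpf B -> cpf (F B)) /\
  (forall B, cpf B -> dom (F B) = F (dom B)) /\
  (forall B, cpf B -> rng (F B) = F (rng B)) /\
  (forall B1 B2, cpf B1 -> cpf B2 -> dom B1 = rng B2 ->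
     F (cprod B1 B2) = cprod (F B1) (F B2)).

Definition is_covering (R S : RQF) (F : (S -> Prop) -> (R -> Prop)) : Prop :=
  (forall x y, cpf x -> cpf y -> F x = F y -> dom x = dom y -> x = y) /\
  (forall e y, is_ident e -> cpf y -> F e = dom y ->
     exists x, cpf x /\ dom x = e /\ F x = y) /\
  (forall x y, cpf x -> cpf y -> F x = F y -> rng x = rng y -> x = y) /\
  (forall e y, is_ident e -> cpf y -> F e = rng y ->
     exists x, cpf x /\ rng x = e /\ F x = y).

Definition is_continuous (R S : RQF) (F : (S -> Prop) -> (R -> Prop)) : Prop :=
  forall U, isOpen U -> isOpen (fun B => U (F B)).

Arguments rqf_morph {R S}.
Arguments preim {R S}.
Arguments is_functor {R S}.
Arguments is_covering {R S}.
Arguments is_continuous {R S}.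

(* Main.v *)
(** Everything rests on one rigidity fact: below a partial isometry [s] an
    element [c] is recovered from its domain as [c = s c^*], so a completely
    prime filter containing [s] is determined by its domain.  Since [phi^-1(B)]
    always contains a partial isometry [s] and [B] then contains the partial
    isometry [phi s], this gives [d]-injectivity, and [d]-surjectivity follows
    by lifting [y] to the filter generated by the products [phi(a) p] with
    [a] in [y] and [p] a projection in [e], and comparing domains.  For
    products, [b1 b2 <= phi x] is first shrunk to [c1 c2] with
    [c1 <= phi s1], [c2 <= phi s2] and [(c1 c2)^* = c2^*]; then
    [x >= (s1 s2) y^*] for [y = s1 s2 /\ x], with [s1] and [s2 y^*] in the
    preimages.  The [r]-statements are the [d]-statements for the opposite
    quantal frame. *)

Require Import Defs.
From Stdlib Require Import FunctionalExtensionality PropExtensionality.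

Set Implicit Arguments.
Unset Strict Implicit.

Lemma set_ext {T : Type} (A B : T -> Prop) : (forall x, A x <-> B x) -> A = B.
Proof.
  intros H; apply functional_extensionality; intros x.
  apply propositional_extensionality; auto.
Qed.

Section Order.
Context {Q : RQF}.

Lemma sup_pair_le (a b : Q) : le a b -> sup (fun z => z = a \/ z = b) = b.
Proof.
  intros Hab; apply le_antisym.
  - apply sup_lub; intros z [-> | ->]; [exact Hab | apply le_refl].
  - apply sup_ub; right; reflexivity.
Qed.

Lemma join_preserving_mono (Q' : RQF) (f : Q -> Q') :
  (forall X, f (sup X) = sup (img f X)) -> forall a b, le a b -> le (f a) (f b).
Proof.
  intros Hf a b Hab; rewrite <- (sup_pair_le Hab), Hf.
  apply sup_ub; exists a; split; [left |]; reflexivity.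
Qed.

Lemma join_preserving_bot_le (Q' : RQF) (f : Q -> Q') :
  (forall X, f (sup X) = sup (img f X)) -> forall b, le (f bot) b.
Proof. intros Hf b; unfold bot; rewrite Hf; apply sup_lub; intros z [x [[] _]]. Qed.

Lemma mul_monol (a b c : Q) : le a b -> le (mul a c) (mul b c).
Proof. apply (join_preserving_mono (mul_supl Q c)). Qed.

Lemma mul_monor (a b c : Q) : le a b -> le (mul c a) (mul c b).
Proof. apply (join_preserving_mono (mul_supr Q c)). Qed.

Lemma mul_mono (a b c d : Q) : le a b -> le c d -> le (mul a c) (mul b d).
Proof. intros H1 H2; eapply le_trans; [apply mul_monol, H1 | apply mul_monor, H2]. Qed.

Lemma star_mono (a b : Q) : le a b -> le (star a) (star b).
Proof. apply (join_preserving_mono (star_sup Q)). Qed.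

Lemma plus_mono (a b : Q) : le a b -> le (plus a) (plus b).
Proof. apply (join_preserving_mono (plus_sup Q)). Qed.

Lemma mulr_proj_le (p q : Q) : le q one -> le (mul p q) p.
Proof. intros Hq; rewrite <- (mul1r Q p) at 2; apply mul_monor, Hq. Qed.

Lemma mull_proj_le (p q : Q) : le p one -> le (mul p q) q.
Proof. intros Hp; rewrite <- (mul1l Q q) at 2; apply mul_monol, Hp. Qed.

Lemma meet_proj_le_mul (p q : Q) : le p one -> le (meet p q) (mul p q).
Proof.
  intros Hp.
  assert (Hm : le (meet p q) one) by (eapply le_trans; [apply meet_lbl | exact Hp]).
  rewrite <- (proj_idem _ _ Hm) at 1; apply mul_mono; [apply meet_lbl | apply meet_lbr].
Qed.

Lemma star_mul_proj (a p : Q) : le p one -> star (mul a p) = mul (star a) p.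
Proof. intros Hp; rewrite star_mulE; apply star_fix, proj_mul; [apply star_proj | exact Hp]. Qed.

Lemma mul_proj_absorb (p q : Q) : le p q -> le q one -> mul q p = p.
Proof.
  intros Hpq Hq; apply le_antisym; [apply mull_proj_le, Hq |].
  rewrite <- (proj_idem _ _ (le_trans _ _ _ _ Hpq Hq)) at 1; apply mul_monol, Hpq.
Qed.

Lemma star_mul_plus_le (b c : Q) : le (plus c) (star b) -> star (mul b c) = star c.
Proof.
  intros Hcb.
  assert (Hc : mul (star b) c = c).
  { rewrite <- (plus_mul Q c) at 1.
    rewrite mulA, (mul_proj_absorb Hcb (star_proj Q b)); apply plus_mul. }
  rewrite star_mulE, Hc; reflexivity.
Qed.

Lemma pisom_le_mul (s c q : Q) : pisom s -> le c s -> le (star c) q -> le c (mul s q).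
Proof. intros Hs Hcs Hcq; rewrite (proj2 (Hs c Hcs)) at 1; apply mul_monor, Hcq. Qed.

End Order.

Section Filters.
Context {Q : RQF}.
Implicit Types A B : Q -> Prop.

Lemma cpf_up A a b : cpf A -> A a -> le a b -> A b.
Proof. intros [_ [H _]]; exact (H a b). Qed.

Lemma cpf_meet A a b : cpf A -> A a -> A b -> A (meet a b).
Proof. intros [_ [_ [H _]]]; exact (H a b). Qed.

Lemma cpf_nbot A : cpf A -> ~ A bot.
Proof. intros [_ [_ [_ [H _]]]]; exact H. Qed.

Lemma cpf_prime A X : cpf A -> A (sup X) -> exists a, X a /\ A a.
Proof. intros [_ [_ [_ [_ H]]]]; exact (H X). Qed.

Lemma cpf_top A : cpf A -> A top.
Proof. intros HA; destruct (proj1 HA) as [a Ha]; apply (cpf_up HA Ha), sup_ub; exact I. Qed.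

Lemma cpf_pisom A : cpf A -> exists s, pisom s /\ A s.
Proof.
  intros HA; destruct (top_pisom Q) as [X [HX Htop]].
  assert (HAX : A (sup X)) by (rewrite Htop; exact (cpf_top HA)).
  destruct (cpf_prime HA HAX) as [s [Xs As]]; exists s; split; [exact (HX s Xs) | exact As].
Qed.

Lemma cpf_mul_proj A p q : cpf A -> A p -> A q -> le p one -> A (mul p q).
Proof.
  intros HA Ap Aq Hp; apply (cpf_up HA (cpf_meet HA Ap Aq)), meet_proj_le_mul, Hp.
Qed.

Lemma cpf_incl_of_dom_incl A B s :
  cpf A -> cpf B -> pisom s -> A s -> B s ->
  (forall z, dom A z -> dom B z) -> forall z, A z -> B z.
Proof.
  intros HA HB Hs As Bs Hd z Az.
  set (w := meet s z).
  assert (Aw : A w) by exact (cpf_meet HA As Az).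
  destruct (Hd (star w) (ex_intro _ w (conj Aw (le_refl _ _)))) as [b [Bb Hb]].
  set (c := meet b s).
  apply (cpf_up HB (cpf_meet HB Bb Bs)); fold c.
  apply le_trans with w; [| apply meet_lbr].
  (* both [c] and [w] lie below [s], so [c = s c^* <= s w^* = w] *)
  rewrite (proj2 (Hs w (meet_lbl _ _ _))).
  apply pisom_le_mul; [exact Hs | apply meet_lbr |].
  eapply le_trans; [apply star_mono, meet_lbl | exact Hb].
Qed.

Lemma cpf_eq_of_dom_eq A B s :
  cpf A -> cpf B -> pisom s -> A s -> B s -> dom A = dom B -> A = B.
Proof.
  intros HA HB Hs As Bs Hd; apply set_ext; intros z; split;
    [apply (cpf_incl_of_dom_incl HA HB Hs As Bs) | apply (cpf_incl_of_dom_incl HB HA Hs Bs As)];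
    intros w; rewrite Hd; auto.
Qed.

Lemma ident_star A g : is_ident A -> A g -> A (star g).
Proof. intros [_ Hd] Ag; rewrite <- Hd; exists g; split; [exact Ag | apply le_refl]. Qed.

Lemma ident_rng A : is_ident A -> rng A = A.
Proof.
  intros HA; pose proof HA as [HcA Hd]; apply set_ext; intros x; split.
  - intros [a [Aa Ha]].
    rewrite <- Hd in Aa; destruct Aa as [a' [Aa' Ha']].
    assert (Aproj : A (meet a one)).
    { apply (cpf_up HcA (ident_star HA Aa')), meet_glb; [exact Ha' | apply star_proj]. }
    apply (cpf_up HcA Aproj).
    rewrite <- (plus_fix _ (meet a one)) by apply meet_lbr.
    eapply le_trans; [apply plus_mono, meet_lbl | exact Ha].
  - intros Ax; rewrite <- Hd in Ax; destruct Ax as [g [Ag Hg]].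
    exists (star g); split; [exact (ident_star HA Ag) |].
    rewrite plus_fix by apply star_proj; exact Hg.
Qed.

Lemma cprod_shrink B1 B2 b1 b2 :
  cpf B1 -> cpf B2 -> dom B1 = rng B2 -> B1 b1 -> B2 b2 ->
  exists c1 c2, B1 c1 /\ B2 c2 /\ le c1 b1 /\ le c2 b2 /\ star (mul c1 c2) = star c2.
Proof.
  intros H1 H2 Hdr Bb1 Bb2.
  assert (Hd : rng B2 (star b1)) by (rewrite <- Hdr; exists b1; split; [exact Bb1 | apply le_refl]).
  destruct Hd as [d [Bd Hd]].
  exists b1, (meet b2 d); split; [exact Bb1 |]; split; [exact (cpf_meet H2 Bb2 Bd) |].
  split; [apply le_refl |]; split; [apply meet_lbl |].
  apply star_mul_plus_le; eapply le_trans; [apply plus_mono, meet_lbr | exact Hd].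
Qed.

End Filters.

(** The opposite quantal frame: multiplication reversed, [^*] and [^+] swapped.
    Its [dom] is [rng], so every [r]-statement is a [d]-statement there. *)
Section Opposite.
Variable Q : RQF.

Lemma op_top_pisom : exists X : Q -> Prop,
  (forall a, X a -> forall b, le b a -> b = mul a (star b) /\ b = mul (plus b) a)
  /\ sup X = sup (fun _ => True).
Proof.
  destruct (top_pisom Q) as [X [HX Htop]]; exists X; split; [| exact Htop].
  intros a Xa b Hb; destruct (HX a Xa b Hb); split; assumption.
Qed.

Lemma op_pisom_mul (a b : Q) :
  (forall c, le c a -> c = mul a (star c) /\ c = mul (plus c) a) ->
  (forall c, le c b -> c = mul b (star c) /\ c = mul (plus c) b) ->
  forall c, le c (mul b a) -> c = mul (mul b a) (star c) /\ c = mul (plus c) (mul b a).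
Proof.
  intros Ha Hb c Hc.
  destruct (pisom_mul Q b a (fun d Hd => conj (proj2 (Hb d Hd)) (proj1 (Hb d Hd)))
              (fun d Hd => conj (proj2 (Ha d Hd)) (proj1 (Ha d Hd))) c Hc).
  split; assumption.
Qed.

Definition rqf_op : RQF := {|
  car := car Q; le := @le Q; sup := @sup Q; meet := @meet Q;
  mul := fun a b => @mul Q b a; one := @one Q; star := @plus Q; plus := @star Q;
  le_refl := le_refl Q; le_trans := le_trans Q; le_antisym := le_antisym Q;
  sup_ub := sup_ub Q; sup_lub := sup_lub Q; meet_lbl := meet_lbl Q;
  meet_lbr := meet_lbr Q; meet_glb := meet_glb Q; meet_sup := meet_sup Q;
  mulA := fun a b c => eq_sym (mulA Q c b a);
  mul1l := mul1r Q; mul1r := mul1l Q;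
  mul_supr := mul_supl Q; mul_supl := mul_supr Q;
  proj_mul := fun p q Hp Hq => proj_mul Q q p Hq Hp;
  proj_comm := fun p q Hp Hq => proj_comm Q q p Hq Hp;
  proj_idem := proj_idem Q;
  star_sup := plus_sup Q; plus_sup := star_sup Q;
  star_proj := plus_proj Q; plus_proj := star_proj Q;
  star_fix := plus_fix Q; plus_fix := star_fix Q;
  mul_star := plus_mul Q; plus_mul := mul_star Q;
  star_mulE := fun a b => plus_mulE Q b a;
  plus_mulE := fun a b => star_mulE Q b a;
  top_pisom := op_top_pisom;
  pisom_mul := op_pisom_mul |}.

Lemma pisom_op (a : Q) : @pisom rqf_op a <-> pisom a.
Proof. split; intros H b Hb; destruct (H b Hb); split; assumption. Qed.

Lemma is_ident_op (e : Q -> Prop) : is_ident e -> @is_ident rqf_op e.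
Proof. intros He; split; [exact (proj1 He) | exact (ident_rng He)]. Qed.

End Opposite.

Lemma rqf_morph_op (R S : RQF) (phi : R -> S) :
  rqf_morph phi -> @rqf_morph (rqf_op R) (rqf_op S) phi.
Proof.
  intros [Hmul [Hsup [Hmeet [Hstar [Hplus [Htop [Hone Hpis]]]]]]].
  refine (conj (fun a b => Hmul b a) (conj Hsup (conj Hmeet (conj Hplus (conj Hstar
            (conj Htop (conj Hone _))))))).
  intros a Ha; apply pisom_op, Hpis, pisom_op, Ha.
Qed.

Section Preimage.
Variables (R S : RQF) (phi : R -> S).
Hypothesis Hphi : rqf_morph phi.

Lemma morph_mul (a b : R) : phi (mul a b) = mul (phi a) (phi b).
Proof. exact (proj1 Hphi a b). Qed.

Lemma morph_sup (X : R -> Prop) : phi (sup X) = sup (img phi X).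
Proof. exact (proj1 (proj2 Hphi) X). Qed.

Lemma morph_meet (a b : R) : phi (meet a b) = meet (phi a) (phi b).
Proof. exact (proj1 (proj2 (proj2 Hphi)) a b). Qed.

Lemma morph_star (a : R) : phi (star a) = star (phi a).
Proof. exact (proj1 (proj2 (proj2 (proj2 Hphi))) a). Qed.

Lemma morph_top : phi top = top.
Proof. exact (proj1 (proj2 (proj2 (proj2 (proj2 (proj2 Hphi)))))). Qed.

Lemma morph_one : phi one = one.
Proof. exact (proj1 (proj2 (proj2 (proj2 (proj2 (proj2 (proj2 Hphi))))))). Qed.

Lemma morph_pisom (a : R) : pisom a -> pisom (phi a).
Proof. exact (proj2 (proj2 (proj2 (proj2 (proj2 (proj2 (proj2 Hphi)))))) a). Qed.

Lemma morph_mono (a b : R) : le a b -> le (phi a) (phi b).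
Proof. apply (join_preserving_mono morph_sup). Qed.

Lemma preim_cpf (B : S -> Prop) : cpf B -> cpf (preim phi B).
Proof.
  intros HB; split; [| split; [| split; [| split]]]; unfold preim.
  - exists top; rewrite morph_top; exact (cpf_top HB).
  - intros a b Ba Hab; exact (cpf_up HB Ba (morph_mono Hab)).
  - intros a b Ba Bb; rewrite morph_meet; exact (cpf_meet HB Ba Bb).
  - intros Bbot; apply (cpf_nbot HB), (cpf_up HB Bbot), join_preserving_bot_le, morph_sup.
  - intros X BX; rewrite morph_sup in BX.
    destruct (cpf_prime HB BX) as [z [[x [Xx ->]] Bz]]; exists x; split; assumption.
Qed.

Lemma dom_preim (B : S -> Prop) : cpf B -> dom (preim phi B) = preim phi (dom B).
Proof.
  intros HB; apply set_ext; intros x; split.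
  - intros [a [Ba Ha]]; exists (phi a); split; [exact Ba |].
    rewrite <- morph_star; apply morph_mono, Ha.
  - intros [b [Bb Hb]]; exists (mul top (meet x one)); split.
    + unfold preim; rewrite morph_mul, morph_meet, morph_one, morph_top.
      apply (cpf_up HB Bb); rewrite <- (mul_star _ b) at 1.
      apply mul_mono; [apply sup_ub; exact I | apply meet_glb; [exact Hb | apply star_proj]].
    + rewrite star_mul_proj by apply meet_lbr.
      eapply le_trans; [apply mull_proj_le, star_proj | apply meet_lbl].
Qed.

Lemma preim_cprod_incl (B1 B2 : S -> Prop) :
  cpf B1 -> cpf B2 -> dom B1 = rng B2 ->
  forall x, preim phi (cprod B1 B2) x -> cprod (preim phi B1) (preim phi B2) x.
Proof.
  intros H1 H2 Hdr x [b1 [b2 [Bb1 [Bb2 Hb]]]].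
  destruct (cpf_pisom (preim_cpf H1)) as [s1 [Hs1 Bs1]].
  destruct (cpf_pisom (preim_cpf H2)) as [s2 [Hs2 Bs2]].
  destruct (cprod_shrink H1 H2 Hdr (cpf_meet H1 Bb1 Bs1) (cpf_meet H2 Bb2 Bs2))
    as [c1 [c2 [Bc1 [Bc2 [Hc1 [Hc2 Hstar]]]]]].
  assert (Hs : pisom (mul s1 s2)) by exact (pisom_mul R s1 s2 Hs1 Hs2).
  set (y := meet (mul s1 s2) x).
  assert (Hcy : le (mul c1 c2) (phi y)).
  { unfold y; rewrite morph_meet, morph_mul; apply meet_glb.
    - apply mul_mono; eapply le_trans; eauto using meet_lbr.
    - eapply le_trans; [| exact Hb]; apply mul_mono; eapply le_trans; eauto using meet_lbl. }
  exists s1, (mul s2 (star y)); split; [exact Bs1 | split].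
  - unfold preim; rewrite morph_mul, morph_star.
    apply (cpf_up H2 Bc2), pisom_le_mul.
    + exact (morph_pisom Hs2).
    + eapply le_trans; [exact Hc2 | apply meet_lbr].
    + rewrite <- Hstar; apply star_mono, Hcy.
  - rewrite mulA, <- (proj2 (Hs y (meet_lbl _ _ _))); apply meet_lbr.
Qed.

Lemma preim_cprod (B1 B2 : S -> Prop) :
  cpf B1 -> cpf B2 -> dom B1 = rng B2 ->
  preim phi (cprod B1 B2) = cprod (preim phi B1) (preim phi B2).
Proof.
  intros H1 H2 Hdr; apply set_ext; intros x; split; [apply preim_cprod_incl; assumption |].
  intros [a1 [a2 [Ba1 [Ba2 Ha]]]]; exists (phi a1), (phi a2).
  split; [exact Ba1 | split; [exact Ba2 |]].
  rewrite <- morph_mul; apply morph_mono, Ha.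
Qed.

Lemma preim_dom_inj (x y : S -> Prop) :
  cpf x -> cpf y -> preim phi x = preim phi y -> dom x = dom y -> x = y.
Proof.
  intros Hx Hy Hpre Hdom.
  destruct (cpf_pisom (preim_cpf Hx)) as [s [Hs xs]].
  assert (ys : y (phi s)) by (change (preim phi y s); rewrite <- Hpre; exact xs).
  exact (cpf_eq_of_dom_eq Hx Hy (morph_pisom Hs) xs ys Hdom).
Qed.

Lemma preim_continuous : is_continuous (preim phi).
Proof.
  intros U HU B HB UB.
  destruct (HU _ (preim_cpf HB) UB) as [a [Ha [Ba HA]]].
  exists (phi a); split; [exact (morph_pisom Ha) | split; [exact Ba |]].
  intros B' HB' B'a; exact (HA _ (preim_cpf HB') B'a).
Qed.

Section DomLift.
Variables (e : S -> Prop) (y : R -> Prop).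
Hypotheses (He : is_ident e) (Hy : cpf y) (Hey : preim phi e = dom y).

Definition dom_lift : S -> Prop :=
  fun z => exists a p, y a /\ e p /\ le p one /\ le (mul (phi a) p) z.

Let HcE : cpf e := proj1 He.

Lemma dom_lift_star a p : y a -> e p -> le p one -> e (star (mul (phi a) p)).
Proof.
  intros ya ep Hp; rewrite star_mul_proj by exact Hp.
  apply (cpf_mul_proj HcE); [| exact ep | apply star_proj].
  rewrite <- morph_star; change (preim phi e (star a)); rewrite Hey.
  exists a; split; [exact ya | apply le_refl].
Qed.

Lemma dom_lift_mem a : y a -> preim phi dom_lift a.
Proof.
  intros ya; exists a, (phi (star a)).
  assert (ea : e (phi (star a))).
  { change (preim phi e (star a)); rewrite Hey; exists a; split; [exact ya | apply le_refl]. }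
  split; [exact ya | split; [exact ea | split]].
  - rewrite morph_star; apply star_proj.
  - rewrite morph_star, mul_star; apply le_refl.
Qed.

Lemma dom_lift_prime X : dom_lift (sup X) -> exists z, X z /\ dom_lift z.
Proof.
  intros [a [p [ya [ep [Hp Hle]]]]].
  destruct (cpf_pisom Hy) as [s [Hs ys]].
  set (c := mul (phi (meet a s)) p).
  assert (Hc : le c (sup (img (meet (phi s)) X))).
  { rewrite <- meet_sup; apply meet_glb.
    - eapply le_trans; [apply mulr_proj_le, Hp | apply morph_mono, meet_lbr].
    - eapply le_trans; [apply mul_monol, morph_mono, meet_lbl | exact Hle]. }
  assert (eX : e (sup (img star (img (meet (phi s)) X)))).
  { rewrite <- star_sup; apply (cpf_up HcE (dom_lift_star (cpf_meet Hy ya ys) ep Hp)).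
    apply star_mono, Hc. }
  destruct (cpf_prime HcE eX) as [v [[w [[z [Xz ->]] ->]] ev]].
  exists z; split; [exact Xz |].
  exists s, (star (meet (phi s) z)); split; [exact ys | split; [exact ev | split]].
  - apply star_proj.
  - rewrite <- (proj2 (morph_pisom Hs (meet_lbl _ (phi s) z))); apply meet_lbr.
Qed.

Lemma dom_lift_cpf : cpf dom_lift.
Proof.
  destruct HcE as [[g eg] _]; destruct Hy as [[a0 ya0] _].
  split; [| split; [| split; [| split]]].
  - exists (mul (phi a0) (star g)), a0, (star g).
    split; [exact ya0 | split; [exact (ident_star He eg) | split; [apply star_proj | apply le_refl]]].
  - intros z z' [a [p [ya [ep [Hp Hle]]]]] Hz.
    exists a, p; split; [exact ya | split; [exact ep | split; [exact Hp | eapply le_trans; eauto]]].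
  - intros z1 z2 [a1 [p1 [ya1 [ep1 [Hp1 H1]]]]] [a2 [p2 [ya2 [ep2 [Hp2 H2]]]]].
    exists (meet a1 a2), (mul p1 p2).
    split; [exact (cpf_meet Hy ya1 ya2) | split; [exact (cpf_mul_proj HcE ep1 ep2 Hp1) |]].
    split; [exact (proj_mul S p1 p2 Hp1 Hp2) |].
    apply meet_glb.
    + eapply le_trans; [| exact H1]; apply mul_mono; [apply morph_mono, meet_lbl | apply mulr_proj_le, Hp2].
    + eapply le_trans; [| exact H2]; apply mul_mono; [apply morph_mono, meet_lbr | apply mull_proj_le, Hp1].
  - intros [a [p [ya [ep [Hp Hle]]]]]; apply (cpf_nbot HcE).
    apply (cpf_up HcE (dom_lift_star ya ep Hp)).
    eapply le_trans; [apply star_mono, Hle | apply join_preserving_bot_le, star_sup].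
  - exact dom_lift_prime.
Qed.

Lemma dom_dom_lift : dom dom_lift = e.
Proof.
  apply set_ext; intros z; split.
  - intros [w [[a [p [ya [ep [Hp Hle]]]]] Hw]].
    apply (cpf_up HcE (dom_lift_star ya ep Hp)).
    eapply le_trans; [apply star_mono, Hle | exact Hw].
  - intros ez; destruct Hy as [[a0 ya0] _].
    pose proof ez as ez'; rewrite <- (proj2 He) in ez'; destruct ez' as [g [eg Hg]].
    exists (mul (phi a0) (star g)); split.
    + exists a0, (star g); split; [exact ya0 | split; [exact (ident_star He eg) |]].
      split; [apply star_proj | apply le_refl].
    + rewrite star_mul_proj by apply star_proj.
      eapply le_trans; [apply mull_proj_le, star_proj | exact Hg].
Qed.

Lemma preim_dom_lift : preim phi dom_lift = y.
Proof.
  destruct (cpf_pisom Hy) as [s [Hs ys]].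
  apply (cpf_eq_of_dom_eq (preim_cpf dom_lift_cpf) Hy Hs (dom_lift_mem ys) ys).
  rewrite (dom_preim dom_lift_cpf), dom_dom_lift; exact Hey.
Qed.

End DomLift.

Lemma preim_dom_surj (e : S -> Prop) (y : R -> Prop) :
  is_ident e -> cpf y -> preim phi e = dom y ->
  exists x, cpf x /\ dom x = e /\ preim phi x = y.
Proof.
  intros He Hy Hey; exists (dom_lift e y).
  split; [exact (dom_lift_cpf He Hy Hey) |].
  split; [exact (dom_dom_lift He Hy Hey) | exact (preim_dom_lift He Hy Hey)].
Qed.

End Preimage.

Theorem mainTheorem12 (R S : RQF) (phi : R -> S) :
  rqf_morph phi ->
  is_functor (preim phi) /\ is_covering (preim phi) /\ is_continuous (preim phi) /\
  (forall B, cpf B -> dom (preim phi B) = preim phi (dom B)) /\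
  (forall B, cpf B -> rng (preim phi B) = preim phi (rng B)).
Proof.
  intros Hphi.
  pose proof (rqf_morph_op Hphi) as Hop.
  assert (Hdom : forall B, cpf B -> dom (preim phi B) = preim phi (dom B))
    by exact (dom_preim Hphi).
  assert (Hrng : forall B, cpf B -> rng (preim phi B) = preim phi (rng B))
    by exact (dom_preim Hop).
  split; [| split; [| split; [exact (preim_continuous Hphi) | split; assumption]]].
  - split; [exact (preim_cpf Hphi) | split; [exact Hdom | split; [exact Hrng |]]].
    exact (preim_cprod Hphi).
  - split; [exact (preim_dom_inj Hphi) | split; [exact (preim_dom_surj Hphi) | split]].
    + exact (preim_dom_inj Hop).
    + intros e y He; exact (preim_dom_surj Hop (is_ident_op He)).
Qed.
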